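(* Let $\mathbb{K}$ be an algebraically closed field of characteristic not $2$ and $d\ge0$ an integer. In each case below, let $q,s,s^*,r$ (those that occur) be nonzero scalars in $\mathbb{K}$ such that $\theta_i\ne\theta_j$, $\theta_i^*\ne\theta_j^*$ for $0\le i<j\le d$ and $\varphi_i\ne0$, $\phi_i\ne0$ for $1\le i\le d$, where $P_i=(1-q^{2i})(1-q^{2i-2d-2})$. Put $$Q_j=q^j+q^{-j},\quad Q_j^*=q^j-q^{-j}\ (j=1,2,\ldots),\quad S=s+\frac1s,\quad S^*=s^*+\frac1{s^*},\quad R=r+\frac1r.$$ Then the Leonard pair corresponding to the given parameter array satisfies the given Askey-Wilson relations. - $q$-Racah: for $\theta_i=sq^{d-2i}+\frac{q^{2i-d}}{s}$, $\theta_i^*=s^*q^{d-2i}+\frac{q^{2i-d}}{s^*}$, $\varphi_i=\frac{q^{2d+2-4i}}{ss^*r}P_i(ss^*-rq^{2i-d-1})(ss^*r-q^{2i-d-1})$, $\phi_i=\frac{q^{2d+2-4i}}{ss^*r}P_i(s^*r-sq^{2i-d-1})(s^*-srq^{2i-d-1})$: $$AW\big(Q_2,0,0,-Q_2^{*2},-Q_2^{*2},-Q_1^{*2}(SS^*+Q_{d+1}R),Q_1Q_1^{*2}(SR+Q_{d+1}S^* ),Q_1Q_1^{*2}(S^*R+Q_{d+1}S)\big).$$ - $q$-Hahn: for $\theta_i=rq^{d-2i}$, $\theta_i^*=s^*q^{d-2i}+\frac{q^{2i-d}}{s^*}$, $\varphi_i=\frac{q^{2d+2-4i}}{r}P_i(s^*r^2-q^{2i-d-1})$,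 $\phi_i=-\frac{q^{d+1-2i}}{rs^*}P_i(s^*-r^2q^{2i-d-1})$: $$AW\big(Q_2,0,0,0,-Q_2^{*2},-Q_1^{*2}(S^*r+Q_{d+1}r^{-1}),Q_1Q_1^{*2},Q_1Q_1^{*2}(S^*r^{-1}+Q_{d+1}r)\big).$$ - Dual $q$-Hahn: for $\theta_i=sq^{d-2i}+\frac{q^{2i-d}}{s}$, $\theta_i^*=rq^{d-2i}$, $\varphi_i=\frac{q^{2d+2-4i}}{r}P_i(sr^2-q^{2i-d-1})$, $\phi_i=\frac{q^{2d+2-4i}}{rs}P_i(r^2-sq^{2i-d-1})$: $$AW\big(Q_2,0,0,-Q_2^{*2},0,-Q_1^{*2}(Sr+Q_{d+1}r^{-1}),Q_1Q_1^{*2}(Sr^{-1}+Q_{d+1}r),Q_1Q_1^{*2}\big).$$ - $q$-Krawtchouk: for $\theta_i=q^{d-2i}$, $\theta_i^*=s^*q^{d-2i}+\frac{q^{2i-d}}{s^*}$, $\varphi_i=s^*q^{2d+2-4i}P_i$, $\phi_i=\frac1{s^*}P_i$: $$AW\big(Q_2,0,0,0,-Q_2^{*2},-Q_1^{*2}S^*,0,Q_1Q_1^{*2}Q_{d+1}\big).$$ - Dual $q$-Krawtchouk: for $\theta_i=sq^{d-2i}+\frac{q^{2i-d}}{s}$, $\theta_i^*=q^{d-2i}$, $\varphi_i=s\,q^{2d+2-4i}P_i$, $\phi_i=\frac{q^{2d+2-4i}}{s}P_i$: $$AW\big(Q_2,0,0,-Q_2^{*2},0,-Q_1^{*2}S,Q_1Q_1^{*2}Q_{d+1},0\big).$$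 - Quantum $q$-Krawtchouk, i.e. $\theta_i=rq^{2i-d}$, $\theta_i^*=rq^{d-2i}$, $\varphi_i=-\frac{q^{d+1-2i}}{r}P_i$, $\phi_i=\frac{q^{2d+2-4i}}{r}P_i(r^3-q^{2i-d-1})$, and also affine $q$-Krawtchouk, i.e. $\theta_i=rq^{d-2i}$, $\theta_i^*=rq^{d-2i}$, $\varphi_i=\frac{q^{2d+2-4i}}{r}P_i(r^3-q^{2i-d-1})$, $\phi_i=-\frac{q^{d+1-2i}}{r}P_i$: in both cases $$AW\big(Q_2,0,0,0,0,-Q_1^{*2}(r^2+Q_{d+1}r^{-1}),Q_1Q_1^{*2},Q_1Q_1^{*2}\big).$$
   Context: $Q_j^{*2}$ means $(Q_j^* )^2$. The displayed sequences $(\theta_0,\ldots,\theta_d;\theta_0^*,\ldots,\theta_d^*;\varphi_1,\ldots,\varphi_d;\phi_1,\ldots,\phi_d)$ are parameter arrays of diameter $d$ in Terwilliger's sense. The Leonard pair corresponding to such an array is, up to isomorphism (simultaneous conjugation), the pair $(A,A^* )$ of linear transformations of a $(d+1)$-dimensional $\mathbb{K}$-vector space whose matrices in some basis are: $A$ is lower bidiagonal with diagonal entries $\theta_0,\theta_1,\ldots,\theta_d$ and all subdiagonal entries equal to $1$; $A^*$ is upper bidiagonal with diagonal entries $\theta_0^*,\theta_1^*,\ldots,\theta_d^*$ and superdiagonal entries $\varphi_1,\ldots,\varphi_d$. A Leonard pair on $V$ is an ordered pair $(A,A^* )$ of linear transformations of $V$ such that there is a basis in which $A^*$ is diagonal and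 $A$ irreducible tridiagonal (tridiagonal with all super- and subdiagonal entries nonzero), and a basis in which $A$ is diagonal and $A^*$ irreducible tridiagonal. ($A^*$ is not an adjoint of $A$.) $AW(\beta,\gamma,\gamma^*,\varrho,\varrho^*,\omega,\eta,\eta^* )$ denotes the pair of Askey-Wilson relations $$A^2A^*-\beta AA^*A+A^*A^2-\gamma(AA^*+A^*A)-\varrho A^*=\gamma^*A^2+\omega A+\eta I,$$ $$A^{*2}A-\beta A^*AA^*+AA^{*2}-\gamma^*(A^*A+AA^* )-\varrho^*A=\gamma A^{*2}+\omega A^*+\eta^*I.$$ *)

(* Defs.v *)
From HB Require Import structures.
From mathcomp Require Import all_boot all_order all_algebra.
Set Implicit Arguments.
Unset Strict Implicit.
Unset Printing Implicit Defensive.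
Import GRing.Theory.
Local Open Scope ring_scope.

(* (theta_0..theta_d; theta*_0..theta*_d; varphi_1..varphi_d; phi_1..phi_d);
   only the entries with index in the displayed ranges are meaningful. *)
Record parray (K : Type) := PArray {
  theta  : nat -> K;
  thetas : nat -> K;
  varphi : nat -> K;
  phi    : nat -> K }.

Definition admissible (K : fieldType) (d : nat) (p : parray K) : Prop :=
  [/\ forall i j, (i < j <= d)%N -> theta p i <> theta p j,
      forall i j, (i < j <= d)%N -> thetas p i <> thetas p j,
      forall i, (1 <= i <= d)%N -> varphi p i <> 0
    & forall i, (1 <= i <= d)%N -> phi p i <> 0].

(* Column convention: column j of M lists the coordinates of f e_j. *)
Definition matrix_in (K : fieldType) (V : vectType K) (n : nat)
    (e : n.-tuple V) (f : 'End(V)) (M : 'M[K]_n) : Prop :=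
  forall j : 'I_n, f e`_j = \sum_(i < n) M i j *: e`_i.

Definition split_lower (K : fieldType) (d : nat) (th : nat -> K) : 'M[K]_d.+1 :=
  \matrix_(i, j) if i == j then th i else if i == j.+1 :> nat then 1 else 0.

(* The superdiagonal entry in row j-1, column j is ph j, for 1 <= j <= d. *)
Definition split_upper (K : fieldType) (d : nat) (th ph : nat -> K)
    : 'M[K]_d.+1 :=
  \matrix_(i, j) if i == j then th i else if j == i.+1 :> nat then ph j else 0.

(* By Terwilliger's classification, when p is a parameter array these pairs
   (A, As) are exactly the Leonard pairs corresponding to p; they form one
   isomorphism class. The split form does not involve phi p. The existence of
   e forces dim V = d + 1. *)
Definition leonard_pair_of (K : fieldType) (d : nat) (p : parray K)
    (V : vectType K) (A As : 'End(V)) : Prop :=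
  exists e : d.+1.-tuple V,
    [/\ basis_of {:V} e,
        matrix_in e A (split_lower d (theta p))
      & matrix_in e As (split_upper d (thetas p) (varphi p))].

Definition AW (K : fieldType) (beta gamma gammas rho rhos omega eta etas : K)
    (V : vectType K) (A As : 'End(V)) : Prop :=
     (A \o A \o As)%VF - beta *: (A \o As \o A)%VF + (As \o A \o A)%VF
       - gamma *: ((A \o As)%VF + (As \o A)%VF) - rho *: As
     = gammas *: (A \o A)%VF + omega *: A + eta *: \1%VF
  /\ (As \o As \o A)%VF - beta *: (As \o A \o As)%VF + (A \o As \o As)%VF
       - gammas *: ((As \o A)%VF + (A \o As)%VF) - rhos *: A
     = gamma *: (As \o As)%VF + omega *: As + etas *: \1%VF.

Section Arrays.
Variables (K : fieldType) (d : nat) (q : K).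

Definition Q (j : nat) : K := q ^+ j + q ^- j.
Definition Qs (j : nat) : K := q ^+ j - q ^- j.

Definition qpow (a b : nat) : K := q ^ (a%:Z - b%:Z).

Definition Pq (i : nat) : K :=
  (1 - q ^+ (2 * i)) * (1 - qpow (2 * i) (2 * d + 2)).

Definition q_racah (s ss r : K) : parray K := PArray
  (fun i => s * qpow d (2 * i) + qpow (2 * i) d / s)
  (fun i => ss * qpow d (2 * i) + qpow (2 * i) d / ss)
  (fun i => qpow (2 * d + 2) (4 * i) / (s * ss * r) * Pq i
     * (s * ss - r * qpow (2 * i) (d + 1))
     * (s * ss * r - qpow (2 * i) (d + 1)))
  (fun i => qpow (2 * d + 2) (4 * i) / (s * ss * r) * Pq i
     * (ss * r - s * qpow (2 * i) (d + 1))
     * (ss - s * r * qpow (2 * i) (d + 1))).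

Definition q_hahn (ss r : K) : parray K := PArray
  (fun i => r * qpow d (2 * i))
  (fun i => ss * qpow d (2 * i) + qpow (2 * i) d / ss)
  (fun i => qpow (2 * d + 2) (4 * i) / r * Pq i
     * (ss * r ^+ 2 - qpow (2 * i) (d + 1)))
  (fun i => - (qpow (d + 1) (2 * i) / (r * ss)) * Pq i
     * (ss - r ^+ 2 * qpow (2 * i) (d + 1))).

Definition dual_q_hahn (s r : K) : parray K := PArray
  (fun i => s * qpow d (2 * i) + qpow (2 * i) d / s)
  (fun i => r * qpow d (2 * i))
  (fun i => qpow (2 * d + 2) (4 * i) / r * Pq i
     * (s * r ^+ 2 - qpow (2 * i) (d + 1)))
  (fun i => qpow (2 * d + 2) (4 * i) / (r * s) * Pq i
     * (r ^+ 2 - s * qpow (2 * i) (d + 1))).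

Definition q_krawtchouk (ss : K) : parray K := PArray
  (fun i => qpow d (2 * i))
  (fun i => ss * qpow d (2 * i) + qpow (2 * i) d / ss)
  (fun i => ss * qpow (2 * d + 2) (4 * i) * Pq i)
  (fun i => ss^-1 * Pq i).

Definition dual_q_krawtchouk (s : K) : parray K := PArray
  (fun i => s * qpow d (2 * i) + qpow (2 * i) d / s)
  (fun i => qpow d (2 * i))
  (fun i => s * qpow (2 * d + 2) (4 * i) * Pq i)
  (fun i => qpow (2 * d + 2) (4 * i) / s * Pq i).

Definition quantum_q_krawtchouk (r : K) : parray K := PArray
  (fun i => r * qpow (2 * i) d)
  (fun i => r * qpow d (2 * i))
  (fun i => - (qpow (d + 1) (2 * i) / r) * Pq i)
  (fun i => qpow (2 * d + 2) (4 * i) / r * Pq i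
     * (r ^+ 3 - qpow (2 * i) (d + 1))).

Definition affine_q_krawtchouk (r : K) : parray K := PArray
  (fun i => r * qpow d (2 * i))
  (fun i => r * qpow d (2 * i))
  (fun i => qpow (2 * d + 2) (4 * i) / r * Pq i
     * (r ^+ 3 - qpow (2 * i) (d + 1)))
  (fun i => - (qpow (d + 1) (2 * i) / r) * Pq i).

End Arrays.

(* Main.v *)
(** All seven arrays belong to one family.  With [y = q^(2i-d)] and
    [z = q^(2i-d-1)] one has [theta_i = a/y + b y], [theta*_i = as/y + bs y] and
    [varphi_i = (z + 1/z - Q_(d+1)) (a as/z - rho + b bs z)].  The last formula
    gives [varphi_0 = varphi_(d+1) = 0], so on the split basis, extended by zero
    vectors, each Askey-Wilson relation amounts to four rational identities in
    [q] and [y], uniform in [i] and valid with any constant for [Q_(d+1)].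
    Exchanging [A] with [A*] reverses the basis, so the two relations follow
    from one local computation. *)
Require Import Defs.
From mathcomp Require Import all_boot all_order all_algebra.
From mathcomp Require Import ring.
Import GRing.Theory.
Local Open Scope ring_scope.
Set Implicit Arguments.
Unset Strict Implicit.

(* [u] is the lowered vector [As v - ts v] itself, not a basis vector, so that
   the lemma also applies at the end of the basis, with [u = 0] and [ph = 0]. *)
Lemma askey_wilson_local (K : fieldType) (V : vectType K) (A As : 'End(V))
    (beta rho omega eta tu tv tw ts tsw tsx ph phw phx : K) (u v w x : V) :
  As v = ts *: v + u -> A u = tu *: u + ph *: v -> A v = tv *: v + w ->
  As w = tsw *: w + phw *: v -> A w = tw *: w + x ->
  As x = tsx *: x + phx *: w ->
  tu ^+ 2 - beta * tu * tv + tv ^+ 2 = rho ->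
  ts - beta * tsw + tsx = 0 ->
  ts * (tv + tw) + ph - beta * (tv * ts + phw + tsw * tw)
    + (tv + tw) * tsw + phx = omega ->
  ts * tv ^+ 2 + ph * (tu + tv) - beta * (tv * (tv * ts + phw) + tv * ph)
    + tv ^+ 2 * ts + (tv + tw) * phw - rho * ts = omega * tv + eta ->
  A (A (As v)) - beta *: A (As (A v)) + As (A (A v)) - rho *: As v
    = omega *: A v + eta *: v.
Proof.
move=> Asv Au Av Asw Aw Asx cu cx cw cv.
(* [L] records coordinates on [u], [v], [w], [x]. Only the direction from equal coordinates to equal
   vectors is used, so these vectors may be dependent or zero. *)
pose L a b c e := a *: u + (b *: v + (c *: w + e *: x)).
have LD a b c e a' b' c' e' :
    L a b c e + L a' b' c' e' = L (a + a') (b + b') (c + c') (e + e').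
  by rewrite /L !scalerDl addrACA; congr (_ + _); rewrite addrACA;
     congr (_ + _); rewrite addrACA.
have LZ k a b c e : k *: L a b c e = L (k * a) (k * b) (k * c) (k * e).
  by rewrite /L !scalerDr !scalerA.
have LN a b c e : - L a b c e = L (- a) (- b) (- c) (- e).
  by rewrite /L !opprD !scaleNr.
have Lu : u = L 1 0 0 0 by rewrite /L !scale0r scale1r !addr0.
have Lv : v = L 0 1 0 0 by rewrite /L !scale0r scale1r !addr0 add0r.
have Lw : w = L 0 0 1 0 by rewrite /L !scale0r scale1r !addr0 !add0r.
have Lx : x = L 0 0 0 1 by rewrite /L !scale0r scale1r !add0r.
(* [A x] and [As u] are unknown, so [A] is computed without an [x] term and [As] without a [u] term;
   the words of the relation, applied to [v], never require more. *)
have AL a b c : A (L a b c 0) = L (a * tu) (a * ph + b * tv) (b + c * tw) c.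
  rewrite {1}/L !linearD !linearZ /= Au Av Aw scale0r addr0.
  by rewrite Lu Lv Lw Lx !(LZ, LD); congr L; ring.
have AsL b c e :
    As (L 0 b c e) = L b (b * ts + c * phw) (c * tsw + e * phx) (e * tsx).
  rewrite {1}/L !linearD !linearZ /= Asv Asw Asx scale0r add0r.
  by rewrite Lu Lv Lw Lx !(LZ, LD); congr L; ring.
rewrite Lv !(AL, AsL) !mul0r !addr0 !(AL, AsL) !mul0r.
rewrite AL !(LZ, LN, LD); congr L.
- by rewrite -cu; ring.
- by transitivity (omega * tv + eta); [rewrite -cv|]; ring.
- by rewrite -cw; ring.
- by transitivity (ts - beta * tsw + tsx); [|rewrite cx]; ring.
Qed.

(** * Maps in split form on a basis extended by zero vectors *)

Lemma lfun_eq_basis (K : fieldType) (V W : vectType K) (n : nat)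
    (e : n.-tuple V) (f g : 'Hom(V, W)) :
  basis_of {:V} e -> (forall i, (i < n)%N -> f e`_i = g e`_i) -> f = g.
Proof.
move=> /span_basis spane fg; apply/lfunP => v.
have := memvf v; rewrite -spane; move: v.
by apply/span_lfunP => _ /(nthP 0)[i + <-]; rewrite size_tuple; apply: fg.
Qed.

(** Entries of [e] past index [d] default to 0, which accounts for the missing subdiagonal entry at
    [j = d] and for all larger [j]. *)
Lemma split_lowerE (K : fieldType) (V : vectType K) (d : nat)
    (e : d.+1.-tuple V) (f : 'End(V)) (th : nat -> K) (j : nat) :
  matrix_in e f (split_lower d th) -> f e`_j = th j *: e`_j + e`_j.+1.
Proof.
move=> fe; have [le_jd|lt_dj] := ltnP j d.+1; last first.
  by rewrite !nth_default ?size_tuple ?linear0 ?scaler0 ?addr0 // ltnW.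
rewrite (fe (Ordinal le_jd)) (bigD1 (Ordinal le_jd)) //= mxE eqxx.
congr (_ + _); have [lt_jd|le_dj] := ltnP j.+1 d.+1.
  rewrite (bigD1 (Ordinal lt_jd)) /= ?mxE -?val_eqE /= ?eqxx ?gtn_eqF //.
  rewrite scale1r big1 ?addr0 // => i /andP[/negPf nij /negPf nijS].
  by rewrite mxE nij; move: nijS; rewrite -val_eqE /= => ->; rewrite scale0r.
rewrite nth_default ?size_tuple // big1 // => i /negPf nij.
by rewrite mxE nij /= ltn_eqF ?scale0r // (leq_trans (ltn_ord i)).
Qed.

(** The two vanishing conditions absorb the boundary: at [j = 0] the truncated [j.-1] is again 0,
    and at [j = d.+1] the left side is 0 while [j.-1 = d] is a genuine basis index. *)
Lemma split_upperE (K : fieldType) (V : vectType K) (d : nat)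
    (e : d.+1.-tuple V) (f : 'End(V)) (th ph : nat -> K) (j : nat) :
  ph 0%N = 0 -> ph d.+1 = 0 ->
  matrix_in e f (split_upper d th ph) ->
  f e`_j = th j *: e`_j + ph j *: e`_j.-1.
Proof.
move=> ph0 phd fe; have [le_jd|] := ltnP j d.+1; last first.
  rewrite leq_eqVlt => /orP[/eqP<-|lt_dj].
    by rewrite nth_default ?size_tuple // phd linear0 scaler0 scale0r addr0.
  rewrite !nth_default ?size_tuple ?linear0 ?scaler0 ?addr0 //.
    by rewrite -ltnS prednK // (leq_trans _ lt_dj).
  exact: ltnW.
rewrite (fe (Ordinal le_jd)) (bigD1 (Ordinal le_jd)) //= mxE eqxx.
congr (_ + _); case: j le_jd => [|j] lt_jd.
  by rewrite ph0 scale0r big1 // => i /negPf nij; rewrite mxE nij scale0r.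
rewrite (bigD1 (Ordinal (ltnW lt_jd))) /= ?mxE -?val_eqE /= ?eqxx ?ltn_eqF //.
rewrite big1 ?addr0 // => i /andP[/negPf nij nijS].
rewrite mxE nij /= eqSS eq_sym; move: nijS; rewrite -val_eqE /= => /negPf->.
by rewrite scale0r.
Qed.

(** * The common q-family *)

Section QFamily.
Variables (K : fieldType) (q : K).
Hypothesis q0 : q != 0.

Definition qeig (a b y : K) : K := a / y + b * y.

Definition qsplit (T a b as_ bs rho y : K) : K :=
  let z := y / q in (z + z^-1 - T) * (a * as_ / z - rho + b * bs * z).

Lemma qpow_inv (m n : nat) : qpow q m n = (qpow q n m)^-1.
Proof. by rewrite /qpow invr_expz opprB. Qed.

Lemma qpow_neq0 (m n : nat) : qpow q m n != 0.
Proof. exact: expfz_neq0. Qed.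

Lemma qpowE (m n : nat) : qpow q m n = q ^+ m / q ^+ n.
Proof. by rewrite /qpow expfzDr // -invr_expz. Qed.

(** Exchanging [(a, b)] with [(as_, bs)] fixes [omega] and swaps the starred and unstarred
    parameters, matching the exchange of [A] and [As]. The parameters enter through equations so
    that each array keeps its own displayed form and leaves only field identities. *)
Lemma aw_of_qfamily (d : nat) (p : parray K) (a b as_ bs rho : K)
    (V : vectType K) (A As : 'End(V)) :
  (forall i, theta p i = qeig a b (qpow q (2 * i) d)) ->
  (forall i, thetas p i = qeig as_ bs (qpow q (2 * i) d)) ->
  (forall i,
     varphi p i = qsplit (Q q (d + 1)) a b as_ bs rho (qpow q (2 * i) d)) ->
  leonard_pair_of d p A As ->
  let T := Q q (d + 1) in
  forall rho1 rho2 omega eta1 eta2 : K,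
  rho1 = - Qs q 2 ^+ 2 * (a * b) ->
  rho2 = - Qs q 2 ^+ 2 * (as_ * bs) ->
  omega = - Qs q 1 ^+ 2 * ((a + b) * (as_ + bs) + T * rho) ->
  eta1 = Q q 1 * Qs q 1 ^+ 2 * ((a + b) * rho + T * (as_ + bs) * (a * b)) ->
  eta2 = Q q 1 * Qs q 1 ^+ 2 * ((as_ + bs) * rho + T * (a + b) * (as_ * bs)) ->
  AW (Q q 2) 0 0 rho1 rho2 omega eta1 eta2 A As.
Proof.
move=> thE thsE phE [e [ebasis Ae Ase]] T _ _ _ _ _ -> -> -> -> ->.
(* At i = 0 and i = d + 1 one has z = q^(-d-1) and z = q^(d+1), the roots of z + 1/z = Q_(d+1). *)
have ph0 : varphi p 0%N = 0.
  rewrite phE /qsplit /Q !qpowE muln0 expr0 addn1 exprS.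
  by field; rewrite ?oner_neq0 ?expf_neq0 ?q0.
have phd : varphi p d.+1 = 0.
  rewrite phE /qsplit /Q !qpowE addn1 mul2n -addnn exprD exprS.
  by field; rewrite ?oner_neq0 ?expf_neq0 ?q0.
have AE j := split_lowerE j Ae.
have AsE j := split_upperE j ph0 phd Ase.
pose y i := qpow q (2 * i) d.
have yS i : y i.+1 = q ^+ 2 * y i by rewrite /y !qpowE mulnS exprD mulrA.
have y0 i : y i != 0 by apply: qpow_neq0.
pose u j := varphi p j *: e`_j.-1.
pose th := qeig a b; pose ths := qeig as_ bs.
pose ph := qsplit T a b as_ bs rho.
(* [y j / q ^+ 2] plays the role of y_(j-1) and makes sense also at [j = 0], where [u j] and
   [ph (y j)] vanish. *)
have Au j : A (u j) = th (y j / q ^+ 2) *: u j + ph (y j) *: e`_j.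
  rewrite /u linearZ /= AE scalerDr !scalerA; case: j => [|j] /=.
    by rewrite -[ph _]phE ph0 !mul0r mulr0 !scale0r.
  rewrite -[ph _]phE mulrC thE; congr (_ * _ *: _ + _); congr qeig.
  by rewrite -/(y j) yS; field.
(* The second relation lowers twice: [u'] is the part of [As (u j)] on e_(j-2), zero for [j] at most
   1. *)
have Asu j : exists2 u', As (u j) = ths (y j / q ^+ 2) *: u j + u' &
    A u' = th (y j / q ^+ 4) *: u' + ph (y j / q ^+ 2) *: u j.
  exists (varphi p j *: u j.-1); rewrite {1}/u.
    rewrite linearZ /= AsE scalerDr !scalerA; case: j => [|j] /=.
      by rewrite ph0 !mul0r mulr0 !scale0r.
    rewrite mulrC thsE; congr (_ * _ *: _ + _); congr qeig.
    by rewrite -/(y j) yS; field.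
  rewrite linearZ /= Au scalerDr !scalerA; case: j => [|j] /=.
    by rewrite /u ph0 !(mul0r, mulr0, scale0r, scaler0, addr0).
  have ->: y j.+1 / q ^+ 4 = y j / q ^+ 2 by rewrite yS; field.
  have ->: y j.+1 / q ^+ 2 = y j by rewrite yS; field.
  by rewrite [_ * th _]mulrC [_ * ph _]mulrC.
have AE' j : A e`_j = th (y j) *: e`_j + e`_j.+1 by rewrite AE thE.
have AsE' j : As e`_j = ths (y j) *: e`_j + u j by rewrite AsE thsE.
have uS j : u j.+1 = ph (y j.+1) *: e`_j by rewrite /u phE.
split; apply: (lfun_eq_basis ebasis) => j _;
  rewrite !(scale0r, subr0, add0r, add_lfunE, opp_lfunE, scale_lfunE,
    comp_lfunE, id_lfunE).
  (* First relation: the local chain is [u j], e_j, e_(j+1), e_(j+2). *)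
  have := AsE' j.+2; have := AsE' j.+1; rewrite !uS !yS => AsS AsSS.
  apply: (askey_wilson_local (AsE' _) (Au _) (AE' _) AsS (AE' _) AsSS);
    rewrite ?yS /th /ths /ph /qeig /qsplit /Q /Qs; field; rewrite ?q0 ?y0 //.
(* Second relation: the roles of [A] and [As] are exchanged and the chain runs backwards, e_(j+1),
   e_j, [u j], [u']. *)
have := AsE' j.+1; have [u' Asuj Au'] := Asu j; rewrite uS => AsS.
apply: (askey_wilson_local (AE' _) AsS (AsE' _) (Au _) Asuj Au');
  rewrite ?yS /th /ths /ph /qeig /qsplit /Q /Qs; field; rewrite ?q0 ?y0 //.
Qed.

(** The factors of P_i are 1 - z q^(d+1) and 1 - z q^(-d-1); their product is the source of the
    end-vanishing factor of [qsplit]. *)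
Lemma PqE (d i : nat) : let z := qpow q (2 * i) d / q in
  Pq d q i = z * (z + z^-1 - Q q (d + 1)).
Proof.
rewrite /= /Pq /Q !qpowE addn1 (_ : 2 * d + 2 = d.+1 * 2)%N; last first.
  by rewrite [RHS]mulnC mulnSr.
rewrite [(2 * i)%N]mulnC !(exprM _ _ 2) (exprS q d); field.
by rewrite ?oner_neq0 ?expf_neq0 ?q0.
Qed.

Lemma qpow_shift (d i : nat) : let z := qpow q (2 * i) d / q in
  ((qpow q (2 * i) (d + 1) = z) * (qpow q (d + 1) (2 * i) = z^-1)
    * (qpow q (2 * d + 2) (4 * i) = z ^- 2))%type.
Proof.
rewrite /= !qpowE addn1 (_ : 2 * d + 2 = d.+1 * 2)%N; last first.
  by rewrite [RHS]mulnC mulnSr.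
rewrite (_ : 4 * i = 2 * i * 2)%N; last by rewrite mulnAC.
rewrite [(2 * i)%N]mulnC !(exprM _ _ 2) (exprS q d).
by split; [split|]; field; rewrite ?oner_neq0 ?expf_neq0 ?q0.
Qed.

End QFamily.

(** * Specialization to the seven arrays *)

Local Ltac aw_parameter := field; do ?[apply/andP; split].

Local Ltac qeig_form :=
  rewrite /= /qeig ?(qpow_inv _ _ (2 * _)); field;
  by rewrite ?qpow_neq0 //; do ?[apply/andP; split].

Local Ltac qsplit_form q0 d i :=
  rewrite /= ?(qpow_shift q0 d i) PqE // /qsplit; field;
  by rewrite ?qpow_neq0 //; do ?[apply/andP; split].

Theorem lemma6p2 (K : closedFieldType) (charK : 2%N \notin [pchar K])
    (d : nat) (V : vectType K) (A As : 'End(V)) :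
  (forall q s ss r : K, q != 0 -> s != 0 -> ss != 0 -> r != 0 ->
     let p := q_racah d q s ss r in
     let S := s + s^-1 in let Ss := ss + ss^-1 in let R := r + r^-1 in
     admissible d p -> leonard_pair_of d p A As ->
     AW (Q q 2) 0 0 (- Qs q 2 ^+ 2) (- Qs q 2 ^+ 2)
        (- Qs q 1 ^+ 2 * (S * Ss + Q q (d + 1) * R))
        (Q q 1 * Qs q 1 ^+ 2 * (S * R + Q q (d + 1) * Ss))
        (Q q 1 * Qs q 1 ^+ 2 * (Ss * R + Q q (d + 1) * S)) A As) /\
  (forall q ss r : K, q != 0 -> ss != 0 -> r != 0 ->
     let p := q_hahn d q ss r in
     let Ss := ss + ss^-1 in
     admissible d p -> leonard_pair_of d p A As ->
     AW (Q q 2) 0 0 0 (- Qs q 2 ^+ 2)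
        (- Qs q 1 ^+ 2 * (Ss * r + Q q (d + 1) * r^-1))
        (Q q 1 * Qs q 1 ^+ 2)
        (Q q 1 * Qs q 1 ^+ 2 * (Ss * r^-1 + Q q (d + 1) * r)) A As) /\
  (forall q s r : K, q != 0 -> s != 0 -> r != 0 ->
     let p := dual_q_hahn d q s r in
     let S := s + s^-1 in
     admissible d p -> leonard_pair_of d p A As ->
     AW (Q q 2) 0 0 (- Qs q 2 ^+ 2) 0
        (- Qs q 1 ^+ 2 * (S * r + Q q (d + 1) * r^-1))
        (Q q 1 * Qs q 1 ^+ 2 * (S * r^-1 + Q q (d + 1) * r))
        (Q q 1 * Qs q 1 ^+ 2) A As) /\
  (forall q ss : K, q != 0 -> ss != 0 ->
     let p := q_krawtchouk d q ss in
     let Ss := ss + ss^-1 in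
     admissible d p -> leonard_pair_of d p A As ->
     AW (Q q 2) 0 0 0 (- Qs q 2 ^+ 2)
        (- Qs q 1 ^+ 2 * Ss)
        0
        (Q q 1 * Qs q 1 ^+ 2 * Q q (d + 1)) A As) /\
  (forall q s : K, q != 0 -> s != 0 ->
     let p := dual_q_krawtchouk d q s in
     let S := s + s^-1 in
     admissible d p -> leonard_pair_of d p A As ->
     AW (Q q 2) 0 0 (- Qs q 2 ^+ 2) 0
        (- Qs q 1 ^+ 2 * S)
        (Q q 1 * Qs q 1 ^+ 2 * Q q (d + 1))
        0 A As) /\
  (forall q r : K, q != 0 -> r != 0 ->
     forall p : parray K,
     p = quantum_q_krawtchouk d q r \/ p = affine_q_krawtchouk d q r ->
     admissible d p -> leonard_pair_of d p A As ->
     AW (Q q 2) 0 0 0 0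
        (- Qs q 1 ^+ 2 * (r ^+ 2 + Q q (d + 1) * r^-1))
        (Q q 1 * Qs q 1 ^+ 2)
        (Q q 1 * Qs q 1 ^+ 2) A As).
Proof.
split; [|split; [|split; [|split; [|split]]]].
- move=> q s ss r q0 s0 ss0 r0 p S Ss R _ lp.
  (* Expanding (s ss - r z)(s ss r - z) / (s ss r z) gives s ss / z - R + z / (s ss); the middle
     coefficient dictates [rho]. *)
  apply: (aw_of_qfamily (a := s) (b := s^-1) (as_ := ss) (bs := ss^-1)
    (rho := R) q0 _ _ _ lp) => [i|i|i|||||]; rewrite /S /Ss /R;
    try by aw_parameter.
  + qeig_form.
  + qeig_form.
  + qsplit_form q0 d i.
- move=> q ss r q0 ss0 r0 p Ss _ lp.
  apply: (aw_of_qfamily (a := r) (b := 0) (as_ := ss) (bs := ss^-1)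
    (rho := r^-1) q0 _ _ _ lp) => [i|i|i|||||]; rewrite /Ss; try by aw_parameter.
  + qeig_form.
  + qeig_form.
  + qsplit_form q0 d i.
- move=> q s r q0 s0 r0 p S _ lp.
  apply: (aw_of_qfamily (a := s) (b := s^-1) (as_ := r) (bs := 0)
    (rho := r^-1) q0 _ _ _ lp) => [i|i|i|||||]; rewrite /S; try by aw_parameter.
  + qeig_form.
  + qeig_form.
  + qsplit_form q0 d i.
- move=> q ss q0 ss0 p Ss _ lp.
  (* Beside the factor coming from P_i, varphi_i has the single term ss / z, whence [rho := 0]. *)
  apply: (aw_of_qfamily (a := 1) (b := 0) (as_ := ss) (bs := ss^-1)
    (rho := 0) q0 _ _ _ lp) => [i|i|i|||||]; rewrite /Ss; try by aw_parameter.
  + qeig_form.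
  + qeig_form.
  + qsplit_form q0 d i.
- move=> q s q0 s0 p S _ lp.
  apply: (aw_of_qfamily (a := s) (b := s^-1) (as_ := 1) (bs := 0)
    (rho := 0) q0 _ _ _ lp) => [i|i|i|||||]; rewrite /S; try by aw_parameter.
  + qeig_form.
  + qeig_form.
  + qsplit_form q0 d i.
(* The two arrays differ by exchanging [a] and [b]; the parameters involve these only through a + b
   and a b, so they coincide. *)
- move=> q r q0 r0 p [] -> _ lp.
  + apply: (aw_of_qfamily (a := 0) (b := r) (as_ := r) (bs := 0)
      (rho := r^-1) q0 _ _ _ lp) => [i|i|i|||||]; try by aw_parameter.
    * qeig_form.
    * qeig_form.
    * qsplit_form q0 d i.
  + apply: (aw_of_qfamily (a := r) (b := 0) (as_ := r) (bs := 0)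
      (rho := r^-1) q0 _ _ _ lp) => [i|i|i|||||]; try by aw_parameter.
    * qeig_form.
    * qeig_form.
    * qsplit_form q0 d i.
Qed.
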